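(* Let $\mathcal X$ be a separable real Hilbert space and let $\mathcal A:D(\mathcal A)\subset\mathcal X\to\mathcal X$ be the generator of an exponentially stable $C_0$-semigroup $t\mapsto e^{\mathcal A t}$. Let $\mathcal B:\mathbb R^m\to\mathcal X$ be a bounded linear operator and let $\mathcal C:D(\mathcal C)\subseteq\mathcal X\to\mathbb R^m$ be a linear operator with $D(\mathcal A)\subseteq D(\mathcal C)$ which is $\mathcal A$-admissible. Assume that $$\operatorname{rank}\{\mathcal C\mathcal A^{-1}\mathcal B\}=m .$$ Let $\mathcal P$ be a bounded, positive, self-adjoint operator on $\mathcal X$ such that, for some real number $\mu>0$, $$\langle \mathcal A\varphi,\mathcal P\varphi\rangle_{\mathcal X}+\langle\mathcal P\varphi,\mathcal A\varphi\rangle_{\mathcal X}\le-\mu\|\varphi\|_{\mathcal X}^2\qquad\forall\varphi\in D(\mathcal A).$$ Then there exist a full rank matrix $K_i\in\mathbb R^{m\times m}$, a bounded linear operator $\mathcal M:\mathcal X\to\mathbb R^m$ and positive real numbers $p$ and $k_i^*$ such that for all $0<k_i<k_i^*$ there exists $\mu_e>0$ such that the operator $$\mathcal P_e=\begin{bmatrix}\mathcal P+p\mathcal M^*\mathcal M & -p\mathcal M^*\\ -p\mathcal M & p\,I_m\end{bmatrix}$$ on $\mathcal X_e=\mathcal X\times\mathbb R^m$ is positive and satisfies, for all $\varphi_e=(\varphi,z)\in D(\mathcal A)\times\mathbb R^m$, $$\langle\mathcal A_e\varphi_e,\mathcal P_e\varphi_e\rangle_{\mathcal X_e}+\langle\mathcal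 P_e\varphi_e,\mathcal A_e\varphi_e\rangle_{\mathcal X_e}\le-\mu_e\left(\|\varphi\|_{\mathcal X}^2+|z|^2\right).$$
   Context: Exponential stability of the semigroup means: there exist positive constants $\nu,k$ such that $\|e^{\mathcal A t}\varphi_0\|_{\mathcal X}\le k e^{-\nu t}\|\varphi_0\|_{\mathcal X}$ for all $\varphi_0\in\mathcal X$, $t\ge0$ (so $0$ is in the resolvent set of $\mathcal A$ and $\mathcal A^{-1}$ is bounded). $\mathcal C$ is $\mathcal A$-admissible means: (i) it is $\mathcal A$-bounded, i.e. there is $c>0$ with $|\mathcal C\varphi|\le c(\|\varphi\|_{\mathcal X}+\|\mathcal A\varphi\|_{\mathcal X})$ for all $\varphi\in D(\mathcal A)$; and (ii) there exist $T>0$, $c_T>0$ such that $\int_0^T|\mathcal C e^{\mathcal A t}\varphi|^2dt\le c_T^2\|\varphi\|_{\mathcal X}^2$ for all $\varphi\in D(\mathcal A)$. $\mathcal X_e=\mathcal X\times\mathbb R^m$ carries the inner product $\langle(\varphi_a,z_a),(\varphi_b,z_b)\rangle_{\mathcal X_e}=\langle\varphi_a,\varphi_b\rangle_{\mathcal X}+z_a^\top z_b$. Given $k_i>0$ and $K_i\in\mathbb R^{m\times m}$, the extended operator $\mathcal A_e$, defined on $D(\mathcal A)\times\mathbb R^m$, is $$\mathcal A_e=\begin{bmatrix}\mathcal A & \mathcal B K_i k_i\\ \mathcal C & 0\end{bmatrix},\qquad \mathcal A_e(\varphi,z)=(\mathcal A\varphi+k_i\mathcal B K_i z,\ \mathcal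 C\varphi).$$ $\mathcal M^*:\mathbb R^m\to\mathcal X$ is the adjoint of $\mathcal M$, $I_m$ is the identity matrix, $|\cdot|$ is the Euclidean norm. A self-adjoint operator $\mathcal P$ is positive if $\langle\varphi,\mathcal P\varphi\rangle>0$ for all $\varphi\ne0$. *)

(* Defs.v *)
From HB Require Import structures.
From mathcomp Require Import all_boot all_order all_algebra.
From mathcomp Require Import all_classical all_reals all_analysis.

Set Implicit Arguments.
Unset Strict Implicit.
Unset Printing Implicit Defensive.

Import Order.TTheory GRing.Theory Num.Theory.
Import numFieldNormedType.Exports.

Local Open Scope classical_set_scope.
Local Open Scope ring_scope.

(* Partially defined linear operators. [pfun] is a total function, but only its
   values on [pdom] are meaningful. *)
Record plinear (R : realType) (V W : lmodType R) := PLinear {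
  pdom : set V;
  pfun :> V -> W;
  pdom_zero : pdom 0;
  pdom_linear : forall (a : R) (u v : V),
    pdom u -> pdom v -> pdom (a *: u + v);
  pfun_linear : forall (a : R) (u v : V),
    pdom u -> pdom v -> pfun (a *: u + v) = a *: pfun u + pfun v
}.

(* The inverse of an injective operator onto its range; where [A x = y] has no
   solution the value is 0. *)
Definition pinverse (R : realType) (V W : lmodType R) (A : plinear V W)
    (y : W) : V :=
  xget 0 [set x | pdom A x /\ A x = y].

(* MathComp-Analysis norms matrices by the maximum of the entries, hence the
   separate Euclidean structure. *)
Definition euclid (R : realType) (m : nat) (u v : 'cV[R]_m) : R :=
  (u^T *m v) 0 0.

Definition enorm (R : realType) (m : nat) (u : 'cV[R]_m) : R :=
  Num.sqrt (euclid u u).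

(* [nV] and [nW] are the norms of [V] and [W]. *)
Definition bounded_op (R : realType) (V W : lmodType R) (nV : V -> R)
    (nW : W -> R) (f : V -> W) : Prop :=
  exists c : R, forall v, nW (f v) <= c * nV v.

Definition adjoint (R : realType) (V W : lmodType R) (dV : V -> V -> R)
    (dW : W -> W -> R) (f : V -> W) (w : W) : V :=
  xget 0 [set x | forall v, dV v x = dW (f v) w].

Definition self_adjoint (R : realType) (V : lmodType R) (d : V -> V -> R)
    (f : V -> V) : Prop :=
  forall u v, d (f u) v = d u (f v).

Definition positive_op (R : realType) (V : lmodType R) (d : V -> V -> R)
    (f : V -> V) : Prop :=
  forall v, v != 0 -> 0 < d v (f v).

Definition separable (T : topologicalType) : Prop :=
  exists2 D : set T, countable D & dense D.

Definition mx_of_op (R : realType) (m n : nat) (f : 'cV[R]_m -> 'cV[R]_n) :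
    'M[R]_(n, m) :=
  \matrix_(i, j) f (delta_mx j 0) i 0.

Section Semigroup.
Context {R : realType} {X : completeNormedModType R}.

(* Semigroups are indexed by [R], but only nonnegative times matter. *)
Definition C0_semigroup (S : R -> {linear X -> X}) : Prop :=
  [/\ forall t, 0 <= t -> bounded_op Num.norm Num.norm (S t),
      forall x, S 0 x = x,
      forall s t x, 0 <= s -> 0 <= t -> S (s + t) x = S s (S t x) &
      forall x, S t x @[t --> 0^'+] --> x].

Definition is_generator (S : R -> {linear X -> X}) (A : plinear X X) : Prop :=
  pdom A = [set x | cvg (t^-1 *: (S t x - x) @[t --> 0^'+])] /\
  forall x, pdom A x -> t^-1 *: (S t x - x) @[t --> 0^'+] --> A x.

Definition exponentially_stable (S : R -> {linear X -> X}) : Prop :=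
  exists nu k : R, [/\ 0 < nu, 0 < k &
    forall x t, 0 <= t -> `|S t x| <= k * expR (- nu * t) * `|x|].

Definition op_bounded (A : plinear X X) (m : nat) (C : plinear X 'cV[R]_m) :
    Prop :=
  exists2 c : R, 0 < c &
    forall x, pdom A x -> enorm (C x) <= c * (`|x| + `|A x|).

Definition admissible (S : R -> {linear X -> X}) (A : plinear X X) (m : nat)
    (C : plinear X 'cV[R]_m) : Prop :=
  op_bounded A C /\
  exists T cT : R, [/\ 0 < T, 0 < cT & forall x, pdom A x ->
    (\int[@lebesgue_measure R]_(t in `[0%R, T])
        ((enorm (C (S t x)) ^+ 2)%:E) <= (cT ^+ 2 * `|x| ^+ 2)%:E)%E].

End Semigroup.

Section Extended.
Context {R : realType} {X : completeNormedModType R} {m : nat}.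
Variable ip : X -> X -> R.

Definition ip_ext (u v : X * 'cV[R]_m) : R := ip u.1 v.1 + euclid u.2 v.2.

Definition A_ext (A : plinear X X) (B : 'cV[R]_m -> X)
    (C : plinear X 'cV[R]_m) (Ki : 'M[R]_m) (ki : R) (u : X * 'cV[R]_m) :
    X * 'cV[R]_m :=
  (A u.1 + ki *: B (Ki *m u.2), C u.1).

Definition P_ext (P : X -> X) (M : X -> 'cV[R]_m) (p : R)
    (u : X * 'cV[R]_m) : X * 'cV[R]_m :=
  let Mstar := adjoint ip (@euclid R m) M in
  (P u.1 + p *: Mstar (M u.1) - p *: Mstar u.2, - p *: M u.1 + p *: u.2).

End Extended.

(* Main.v *)
(* Since the semigroup is exponentially stable, A is a bijection of D(A) onto X
   with bounded inverse, so M = C A^-1 is bounded and M A = C on D(A). Along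
   the closed loop z - M phi then evolves by -k_i M B K_i z, which is -k_i z
   for K_i = (M B)^-1. With p = 1 the form of P_e is
   <phi, P phi> + |z - M phi|^2, whose derivative is at most
   -mu |phi|^2 - 2 k_i |z|^2 plus cross terms of size O(k_i |phi| |z|); these
   are absorbed by Young's inequality for small k_i. *)

Require Import Defs.
From HB Require Import structures.
From mathcomp Require Import all_boot all_order all_algebra.
From mathcomp Require Import all_classical all_reals all_analysis.
From mathcomp Require Import ring lra.

Set Implicit Arguments.
Unset Strict Implicit.
Unset Printing Implicit Defensive.

Import Order.TTheory GRing.Theory Num.Theory.
Import numFieldNormedType.Exports.

Local Open Scope classical_set_scope.
Local Open Scope ring_scope.

(** * Bounds and real inner products *)

Lemma bounded_op_gt0 (R : realType) (V W : lmodType R) (nV : V -> R)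
    (nW : W -> R) (f : V -> W) :
  (forall v, 0 <= nV v) -> bounded_op nV nW f ->
  exists2 c : R, 0 < c & forall v, nW (f v) <= c * nV v.
Proof.
move=> nV_ge0 [c fc]; exists (`|c| + 1); first by rewrite ltr_wpDl.
move=> v; apply: (le_trans (fc v)); apply: ler_wpM2r => //.
by rewrite (le_trans (ler_norm c)) // lerDl.
Qed.

Lemma dotC (R : realType) (V : lmodType R) (d : {dot V for idfun}) (u v : V) :
  d u v = d v u.
Proof. by rewrite hermC expr0 mul1r. Qed.

Lemma dotZl (R : realType) (V : lmodType R) (d : {dot V for idfun})
    (a : R) (u v : V) : d (a *: u) v = a * d u v.
Proof. exact: (linearZl_LR d v a u). Qed.

Lemma dotDl (R : realType) (V : lmodType R) (d : {dot V for idfun})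
    (u v w : V) : d (u + v) w = d u w + d v w.
Proof. exact: linearDl. Qed.

Lemma dotNl (R : realType) (V : lmodType R) (d : {dot V for idfun})
    (u v : V) : d (- u) v = - d u v.
Proof. exact: linearNl. Qed.

Lemma dotZr (R : realType) (V : lmodType R) (d : {dot V for idfun})
    (a : R) (u v : V) : d u (a *: v) = a * d u v.
Proof. by rewrite dotC dotZl dotC. Qed.

Lemma dotDr (R : realType) (V : lmodType R) (d : {dot V for idfun})
    (u v w : V) : d u (v + w) = d u v + d u w.
Proof. by rewrite dotC dotDl !(dotC d u). Qed.

Lemma dotNr (R : realType) (V : lmodType R) (d : {dot V for idfun})
    (u v : V) : d u (- v) = - d u v.
Proof. by rewrite dotC dotNl dotC. Qed.

Lemma dot_ge0 (R : realType) (V : lmodType R) (d : {dot V for idfun})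
    (u : V) : 0 <= d u u.
Proof.
have [->|/neq0_dnorm_gt0/ltW//] := eqVneq u 0.
by rewrite linear0l.
Qed.

(** The square of [s *: u - v] is nonnegative; expand and divide by [s]. *)
Lemma dot_young (R : realType) (V : lmodType R) (d : {dot V for idfun})
    (s : R) (u v : V) :
  0 < s -> 2 * d u v <= s * d u u + s^-1 * d v v.
Proof.
move=> s_gt0; have := dot_ge0 d (s *: u - v).
rewrite dotDl !dotDr !dotNl !dotNr !dotZl !dotZr (dotC d v u) => h.
rewrite -(ler_pM2l s_gt0) mulrDr mulVKf ?gt_eqF //; lra.
Qed.

(** [N] is left arbitrary so that the result serves both the norm of [X] and [enorm], which is not
    the norm that column vectors carry. *)
Lemma dot_CauchySchwarz (R : realType) (V : lmodType R)
    (d : {dot V for idfun}) (N : V -> R) :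
  (forall x, 0 <= N x) -> (forall x, d x x = N x ^+ 2) ->
  forall u v, `|d u v| <= N u * N v.
Proof.
move=> N_ge0 d_norm.
have N_gt0 x y : d y y = N x ^+ 2 -> y != 0 -> 0 < N x.
  move=> dy y0; rewrite lt0r N_ge0 andbT.
  by rewrite -sqrf_eq0 -dy gt_eqF // neq0_dnorm_gt0.
(* Here [u'] is [u] or [- u]: both signs of the absolute value are covered while [N] is only
   evaluated at [u]. *)
suff le1 u u' v : d u' u' = N u ^+ 2 -> d u' v <= N u * N v.
  move=> u v; rewrite ler_norml le1 // andbT lerNl -dotNl.
  by rewrite le1 // dotNl dotNr opprK.
move=> uu'; have [->|/(N_gt0 _ _ uu') u_gt0] := eqVneq u' 0.
  by rewrite linear0l mulr_ge0.
have [->|/(N_gt0 _ _ (d_norm v)) v_gt0] := eqVneq v 0.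
  by rewrite linear0r mulr_ge0.
(* The weight [N v / N u] makes the two terms of Young's inequality equal. *)
have := dot_young d u' v (divr_gt0 v_gt0 u_gt0).
rewrite uu' d_norm invf_div !expr2 !mulrA divfK ?gt_eqF // divfK ?gt_eqF //.
lra.
Qed.

(** * The Euclidean inner product on column vectors *)

Lemma euclid_bilinear (R : realType) (m : nat) :
  bilinear_for *%R *%R (@euclid R m).
Proof.
split=> [v a x y|u a x y].
  by rewrite /euclid linearP /= mulmxDl -scalemxAl !mxE.
by rewrite /euclid linearP /= !mxE.
Qed.

HB.instance Definition _ (R : realType) (m : nat) :=
  @bilinear_isBilinear.Build R 'cV[R]_m 'cV[R]_m R *%R *%R (@euclid R m)
    (euclid_bilinear R m).

Lemma euclid_sym (R : realType) (m : nat) (u v : 'cV[R]_m) :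
  euclid u v = (-1) ^+ false * idfun (euclid v u).
Proof.
rewrite expr0 mul1r /euclid !mxE; apply: eq_bigr => i _.
by rewrite !mxE mulrC.
Qed.

HB.instance Definition _ (R : realType) (m : nat) :=
  isHermitianSesquilinear.Build R 'cV[R]_m false idfun (@euclid R m)
    (@euclid_sym R m).

Lemma euclid_gt0 (R : realType) (m : nat) (u : 'cV[R]_m) :
  u != 0 -> 0 < euclid u u.
Proof.
move=> u0; rewrite /euclid mxE; under eq_bigr do rewrite mxE -expr2.
rewrite lt0r sumr_ge0 ?andbT => [|i _]; last exact: sqr_ge0.
apply: contra u0 => /eqP/psumr_eq0P s0; apply/eqP/colP => i.
by apply/eqP; rewrite mxE -sqrf_eq0; apply/eqP/s0 => // j _; exact: sqr_ge0.
Qed.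

HB.instance Definition _ (R : realType) (m : nat) :=
  isDotProduct.Build R 'cV[R]_m (@euclid R m) (@euclid_gt0 R m).

Lemma enorm_ge0 (R : realType) (m : nat) (u : 'cV[R]_m) : 0 <= enorm u.
Proof. exact: sqrtr_ge0. Qed.

Lemma enorm_sqr (R : realType) (m : nat) (u : 'cV[R]_m) :
  enorm u ^+ 2 = euclid u u.
Proof.
by rewrite sqr_sqrtr // dot_ge0.
Qed.

(** * Completeness and the Riesz representation *)

Lemma cauchy_seq_limit (R : realType) (X : completeNormedModType R)
    (x : nat -> X) :
  (forall e, 0 < e ->
     exists N, forall n, (N <= n)%N -> `|x n - x N| <= e) ->
  exists l : X, x n @[n --> \oo] --> l.
Proof.
move=> cx; suff : cvg (x n @[n --> \oo]) by exists (lim (x n @[n --> \oo])).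
apply/cauchy_cvgP/cauchy_exP => e e_gt0.
have [N xN] := cx _ (divr_gt0 e_gt0 (ltr0n _ 2)).
exists (x N); exists N => // n /= Nn.
rewrite /= -ball_normE /= distrC (le_lt_trans (xN _ Nn)) //.
rewrite ltr_pdivrMr // ltr_pMr //.
by rewrite ltr1n.
Qed.

(* The representing vector minimises [`|x|^2 - 2 f x]. *)
Lemma riesz_representation (R : realType) (X : completeNormedModType R)
    (ip : {dot X for idfun}) (f : {scalar X}) :
  (forall x, ip x x = `|x| ^+ 2) ->
  bounded_op Num.norm Num.norm f -> exists x, forall v, ip x v = f v.
Proof.
move=> ip_norm /(bounded_op_gt0 (@normr_ge0 _ _)) [c c_gt0 fc].
pose q x := `|x| ^+ 2 - 2 * f x.
have q_ge x : - c ^+ 2 <= q x.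
  have := fc x; rewrite ler_norml => /andP[_ fx].
  by have := sqr_ge0 (`|x| - c); rewrite /q; lra.
have q_inf : has_inf (range q).
  by split; [exists (q 0), 0 | exists (- c ^+ 2) => _ [x _ <-]].
set d := inf (range q).
have d_le x : d <= q x by apply: ge_inf; [exact: q_inf.2 | exists x].
(* By the parallelogram law the left side is [2 * q x + 2 * q y] minus four times [q] at the
   midpoint, so near-minimisers are close to each other. *)
have q_mid x y : `|x - y| ^+ 2 <= 2 * (q x - d) + 2 * (q y - d).
  have := d_le (2^-1 *: (x + y)).
  have fm : f (2^-1 *: (x + y)) = 2^-1 * (f x + f y) by rewrite linearZ linearD.
  rewrite /q fm -!ip_norm dotZl dotZr.
  rewrite !dotDl !dotDr !dotNl !dotNr (dotC ip y x).
  set a := ip x x; set b := ip x y; set g := ip y y; lra.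
have /choice[x_ qx] : forall n : nat, exists x, q x < d + n.+1%:R^-1.
  move=> n; have n_gt0 : 0 < n.+1%:R^-1 :> R by rewrite invr_gt0.
  by have [_ [x _ <-] qx] := inf_adherent n_gt0 q_inf; exists x.
have [l xl] : exists l : X, x_ n @[n --> \oo] --> l.
  apply: cauchy_seq_limit => e e_gt0.
  have e4 : 0 < e ^+ 2 / 4 by rewrite divr_gt0 ?exprn_gt0.
  have [N _ hN] := near_infty_natSinv_lt (PosNum e4).
  exists N => n Nn; rewrite -ler_sqr ?nnegrE ?(ltW e_gt0) //.
  have hn k : (N <= k)%N -> k.+1%:R^-1 < e ^+ 2 / 4 := hN k.
  have := hn _ Nn; have := hn N (leqnn N).
  have := qx n; have := qx N; have := q_mid (x_ n) (x_ N). 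
  move: (q (x_ n)) (q (x_ N)) (n.+1%:R^-1) (N.+1%:R^-1) => qn qN an aN; lra.
exists l => v; apply/eqP; rewrite -subr_eq0; set a := ip l v - f v.
(* This is the variation of [q] at the minimiser [l] in direction [v]. It is obtained in the limit
   from [d <= q (x_ n + s *: v)], replacing [x_ n] by [l] only inside the inner product. *)
have quad s : 0 <= s ^+ 2 * `|v| ^+ 2 + 2 * s * a.
  have f_shift n : f (x_ n + s *: v) = f (x_ n) + s * f v.
    by rewrite linearD linearZ.
  have lim0 :
      2 * `|s| * `|v| * `|l - x_ n| + n.+1%:R^-1 @[n --> \oo] --> (0 : R).
    rewrite -[0 in X in _ --> X]addr0; apply: cvgD; last exact: cvg_harmonic.
    rewrite -(mulr0 (2 * `|s| * `|v|)); apply: cvgMr.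
    rewrite -(@normr0 _ X) -(subrr l); apply: cvg_norm; apply: cvgB => //.
    exact: cvg_cst.
  rewrite -oppr_le0; apply: (cvgr_to_ge lim0); apply: nearW => n.
  have := d_le (x_ n + s *: v); have := qx n.
  have := dot_CauchySchwarz (@normr_ge0 _ _) ip_norm (l - x_ n) v.
  rewrite dotDl dotNl => cs.
  have : `|s * (ip l v - ip (x_ n) v)| <= `|s| * (`|l - x_ n| * `|v|).
    by rewrite normrM ler_wpM2l.
  rewrite ler_norml => /andP[cs1 cs2].
  rewrite /q f_shift -!ip_norm !dotDl !dotDr !dotZl !dotZr (dotC ip v).
  rewrite !ip_norm /a; move: (n.+1%:R^-1) => r. lra.
(* A near-optimal [s], which makes the quadratic negative unless [a = 0]; the [+ 1] keeps the
   denominator positive when [v = 0]. *)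
have := quad (- a / (`|v| ^+ 2 + 1)).
have v1 : 0 < `|v| ^+ 2 + 1 by rewrite ltr_wpDl ?sqr_ge0.
set w := `|v| ^+ 2.
have -> : (- a / (w + 1)) ^+ 2 * w + 2 * (- a / (w + 1)) * a =
  - (a ^+ 2 * ((w + 2) / (w + 1) ^+ 2)).
  by field; rewrite gt_eqF.
rewrite oppr_ge0 pmulr_lle0; last first.
  by rewrite divr_gt0 ?exprn_gt0 // ltr_wpDl ?sqr_ge0.
by rewrite real_exprn_even_le0 ?num_real.
Qed.

(** * Riemann sums along a semigroup and surjectivity of its generator *)

(** Each term is [S (i.+1%:R * h) x - S (i%:R * h) x], so the sum telescopes. It is the discrete
    form of integrating [S s (A x)] over [s]. *)
Lemma semigroup_sum (R : realType) (X : completeNormedModType R)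
    (S : R -> {linear X -> X}) (h : R) (N : nat) (x : X) :
  C0_semigroup S -> 0 <= h ->
  \sum_(i < N) S (i%:R * h) (S h x - x) = S (N%:R * h) x - x.
Proof.
move=> [_ S0 SD _] h_ge0; rewrite -(big_mkord xpredT (fun i => S (i%:R * h) _)).
rewrite (eq_bigr (fun i => S (i.+1%:R * h) x - S (i%:R * h) x)) => [|i _].
  by rewrite telescope_sumr // mul0r S0.
by rewrite linearB /= -SD ?mulr_ge0 // mulrSr mulrDl mul1r.
Qed.

(** The same telescoping after [S h] is commuted past each term: the discrete form of applying [A]
    to the integral of [S s x]. *)
Lemma semigroup_sum_image (R : realType) (X : completeNormedModType R)
    (S : R -> {linear X -> X}) (h : R) (N : nat) (x : X) :
  C0_semigroup S -> 0 <= h ->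
  S h (\sum_(i < N) S (i%:R * h) x) - \sum_(i < N) S (i%:R * h) x =
  S (N%:R * h) x - x.
Proof.
move=> S_C0 h_ge0; rewrite -(semigroup_sum N x S_C0 h_ge0).
have [_ _ SD _] := S_C0; rewrite linear_sum -sumrB; apply: eq_bigr => i _.
by rewrite linearB /= -!SD ?mulr_ge0 // (addrC h).
Qed.

Lemma semigroup_sum_le (R : realType) (X : completeNormedModType R)
    (S : R -> {linear X -> X}) (k h : R) (N : nat) (x : X) :
  (forall t y, 0 <= t -> `|S t y| <= k * `|y|) -> 0 <= h ->
  `|\sum_(i < N) S (i%:R * h) x| <= N%:R * (k * `|x|).
Proof.
move=> S_le h_ge0; apply: (le_trans (ler_norm_sum _ _ _)).
rewrite mulr_natl -[X in _ *+ X]card_ord -sumr_const.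
by apply: ler_sum => i _; apply: S_le; rewrite mulr_ge0.
Qed.

Lemma semigroup_sum_near (R : realType) (X : completeNormedModType R)
    (S : R -> {linear X -> X}) (h e : R) (N : nat) (x : X) :
  0 <= h -> (forall t, 0 <= t -> t <= N%:R * h -> `|S t x - x| <= e) ->
  `|\sum_(i < N) S (i%:R * h) x - N%:R *: x| <= N%:R * e.
Proof.
move=> h_ge0 S_near.
rewrite scaler_nat -[X in x *+ X]card_ord -sumr_const -sumrB.
apply: (le_trans (ler_norm_sum _ _ _)).
rewrite mulr_natl -[X in _ *+ X]card_ord -sumr_const.
apply: ler_sum => i _; apply: S_near; first by rewrite mulr_ge0.
by rewrite ler_wpM2r // ler_nat ltnW.
Qed.

(** The telescoped sum has norm at least [|x| / 2], and each of its [N] terms at most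
    [k * |S h x - x|]. This turns a small defect over one step into a small vector. *)
Lemma semigroup_step_bounded_below (R : realType)
    (X : completeNormedModType R) (S : R -> {linear X -> X})
    (k h : R) (N : nat) (x : X) :
  C0_semigroup S -> (forall t y, 0 <= t -> `|S t y| <= k * `|y|) -> 0 <= h ->
  (forall y, `|S (N%:R * h) y| <= `|y| / 2) ->
  `|x| <= 2 * (N%:R * (k * `|S h x - x|)).
Proof.
move=> S_C0 S_le h_ge0 S_half.
have := semigroup_sum_le N (S h x - x) S_le h_ge0.
rewrite semigroup_sum // => xh; have := S_half x.
have := ler_normB (S (N%:R * h) x) (S (N%:R * h) x - x).
rewrite opprB addrCA subrr addr0; lra.
Qed.

(** The limit in [C0_semigroup] runs over [t > 0]; [t = 0] is added to cover the first term of a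
    Riemann sum. *)
Lemma semigroup_near0 (R : realType) (X : completeNormedModType R)
    (S : R -> {linear X -> X}) (e : R) (x : X) :
  C0_semigroup S -> 0 < e ->
  exists2 r, 0 < r & forall t, 0 <= t -> t < r -> `|S t x - x| <= e.
Proof.
move=> [_ S0 _ S_cvg] e_gt0.
have /cvgrPdist_le/(_ _ e_gt0) := S_cvg x.
rewrite near_withinE => -[r /= r_gt0 xr]; exists r => // t.
rewrite le_eqVlt => /predU1P[<- _|t_gt0 tr].
  by rewrite S0 subrr normr0 ltW.
by rewrite distrC; apply: xr => //; rewrite /= sub0r normrN gtr0_norm.
Qed.

(** A solution is a fixed point of the contraction sending [x] to [L x - y]. *)
Lemma half_contraction_solvable (R : realType) (X : completeNormedModType R)
    (L : {linear X -> X}) (y : X) :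
  (forall x, `|L x| <= `|x| / 2) -> exists x, L x - x = y.
Proof.
move=> L_half; pose f x := L x - y.
have fT : set_fun [set: X] [set: X] f by [].
pose F : {fun [set: X] >-> [set: X]} := HB.pack f (isFun.Build _ _ _ _ f fT).
have F_ctr : is_contraction F.
  exists (2^-1)%:nng; split; first by rewrite /=; lra.
  move=> [u v] _ /=; rewrite /f opprB addrA subrK -linearB.
  by rewrite (le_trans (L_half _)) // mulrC.
have [|x _ xf] := banach_fixed_point F_ctr closedT; first by exists 0.
by exists x; rewrite {2}xf /= /f opprB addrCA subrr addr0.
Qed.

Lemma generator_intro (R : realType) (X : completeNormedModType R)
    (S : R -> {linear X -> X}) (A : plinear X X) (x y : X) :
  is_generator S A ->
  (forall e, 0 < e -> exists2 r, 0 < r &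
     forall t, 0 < t -> t < r -> `|S t x - x - t *: y| <= t * e) ->
  pdom A x /\ A x = y.
Proof.
move=> [domA A_lim] xy.
have xy_cvg : t^-1 *: (S t x - x) @[t --> 0^'+] --> y.
  apply/cvgrPdist_le => e /xy[r r_gt0 xyr]; rewrite near_withinE.
  exists r => //= t; rewrite /= sub0r normrN => tr t_gt0.
  rewrite gtr0_norm // in tr.
  rewrite distrC -(ler_pM2l t_gt0) -{1}(gtr0_norm t_gt0) -normrZ scalerBr.
  by rewrite scalerA divff ?gt_eqF // scale1r; exact: xyr.
have xA : pdom A x by rewrite domA /=; apply/cvg_ex; exists y.
split=> //; exact: (cvg_unique (@norm_hausdorff _ _) (A_lim _ xA) xy_cvg).
Qed.

(* The preimage of [y] is the integral of [S s v] over [0 <= s <= T], where [T]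
   is so large that [S T] is a half contraction and [v] solves [S T v - v = y];
   it is built as a limit of dyadic Riemann sums. *)
Lemma stable_generator_surjective (R : realType) (X : completeNormedModType R)
    (S : R -> {linear X -> X}) (A : plinear X X) (y : X) :
  C0_semigroup S -> is_generator S A -> exponentially_stable S ->
  exists x, pdom A x /\ A x = y.
Proof.
move=> S_C0 A_gen [nu [k [nu_gt0 k_gt0 S_exp]]].
have [_ _ SD _] := S_C0.
have S_le t x : 0 <= t -> `|S t x| <= k * `|x|.
  move=> t_ge0; apply: (le_trans (S_exp _ _ t_ge0)).
  rewrite ler_wpM2r // ler_piMr ?(ltW k_gt0) // -expR0 ler_expR mulNr oppr_le0.
  by rewrite mulr_ge0 // ltW.
(* With this [T] the decay factor is [k * expR (- (2 * k))], at most [k / (1 + 2 * k)] and hence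
   below one half. *)
pose T := 2 * k / nu.
have T_gt0 : 0 < T by rewrite divr_gt0 ?mulr_gt0.
have S_half x : `|S T x| <= `|x| / 2.
  apply: (le_trans (S_exp _ _ (ltW T_gt0))).
  rewrite mulrC ler_wpM2l // mulNr (mulrC nu) /T divfK ?gt_eqF //.
  rewrite expRN ler_pdivrMr ?expR_gt0 //.
  by have := expR_ge1Dx (2 * k); lra.
have [v Tv] := half_contraction_solvable y S_half.
pose h n : R := T / (2 ^ n)%:R.
have pow_gt0 n : 0 < (2 ^ n)%:R :> R by rewrite ltr0n expn_gt0.
have h_gt0 n : 0 < h n by rewrite divr_gt0.
have powh n : (2 ^ n)%:R * h n = T by rewrite mulrC divfK ?gt_eqF.
have h_cvg : h n @[n --> \oo] --> (0 : R).
  rewrite -(mulr0 T); apply: cvgMr.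
  apply/cvgrPdist_lt => e e_gt0.
  have [N _ hN] := near_infty_natSinv_expn_lt (PosNum e_gt0).
  exists N => // n /= Nn; rewrite sub0r normrN gtr0_norm ?invr_gt0 //.
  by have := hN n Nn; rewrite /= natrX div1r.
pose x n := h n *: \sum_(i < 2 ^ n) S (i%:R * h n) v.
(* The sum telescopes to [S T v - v = y], so the difference quotient of [x n] at its own step [h n]
   is exactly [y]. *)
have x_step n : S (h n) (x n) - x n = h n *: y.
  rewrite /x linearZ -scalerBr semigroup_sum_image ?ltW //.
  by rewrite powh Tv.
have x_steps n N :
    S (N%:R * h n) (x n) - x n = h n *: \sum_(i < N) S (i%:R * h n) y.
  rewrite -semigroup_sum ?ltW // x_step scaler_sumr.
  by apply: eq_bigr => i _; rewrite linearZ.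
have x_near n N e :
    (forall t, 0 <= t -> t <= N%:R * h n -> `|S t y - y| <= e) ->
    `|S (N%:R * h n) (x n) - x n - (N%:R * h n) *: y| <= N%:R * h n * e.
  move=> ye; rewrite x_steps (mulrC N%:R) -(scalerA (h n) _ y).
  rewrite -scalerBr normrZ gtr0_norm // -(mulrA (h n)) ler_pM2l //.
  by apply: semigroup_sum_near => //; exact: ltW.
have [l xl] : exists l : X, x n @[n --> \oo] --> l.
  apply: cauchy_seq_limit => e e_gt0.
  (* Chosen so that the final bound [2 * 2 ^ m * k * h m] times this constant equals [e], because
     [2 ^ m * h m = T]. *)
  have e'_gt0 : 0 < e / (2 * k * T) by rewrite divr_gt0 // mulr_gt0 // mulr_gt0.
  have [r r_gt0 yr] := semigroup_near0 y S_C0 e'_gt0.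
  have [m _ hm] : \forall n \near \oo, h n < r by exact: (cvgr_lt _ h_cvg).
  exists m => n mn; have nm : (2 ^ (n - m))%:R * h n = h m.
    have pow_neq0 := lt0r_neq0 (pow_gt0 m); apply: (mulfI pow_neq0).
    by rewrite mulrA -natrM -expnD subnKC // !powh.
  (* The coarse step [h m] consists of [2 ^ (n - m)] fine ones. Over it [x n] moves by nearly
     [h m *: y] and [x m] by exactly that, so [x n - x m] has a small defect and is itself small. *)
  have := @semigroup_step_bounded_below _ _ S k (h m) (2 ^ m) (x n - x m)
    S_C0 S_le.
  rewrite powh => /(_ (ltW (h_gt0 _)) S_half) /le_trans; apply.
  have -> : S (h m) (x n - x m) - (x n - x m) =
      S (h m) (x n) - x n - h m *: y.
    by rewrite linearB -(x_step m) /= !opprB addrACA [RHS]addrACA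
      [- x n - _]addrC.
  apply: (@le_trans _ _ (2 * ((2 ^ m)%:R * (k * (h m * (e / (2 * k * T))))))).
    rewrite ler_pM2l // ler_pM2l // ler_pM2l // -nm; apply: x_near => t t_ge0.
    rewrite nm => thm; apply: yr => //; apply: (le_lt_trans thm).
    by apply: hm => /=.
  rewrite (_ : 2 * _ = (2 ^ m)%:R * h m * (e / T)); last first.
    by field; rewrite !gt_eqF.
  by rewrite powh mulrC divfK ?gt_eqF.
exists l; apply: (generator_intro A_gen) => e e_gt0.
have [r r_gt0 yr] := semigroup_near0 y S_C0 e_gt0.
exists r => // t t_gt0 tr; apply/ler_addgt0Pr => b b_gt0.
(* The slack [b] is shared by four errors: two of size [k * c] and two of size [c]. *)
pose c := b / (2 * k + 2).
have k2_gt0 : 0 < 2 * k + 2 by rewrite addr_gt0 ?mulr_gt0.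
have c_gt0 : 0 < c by rewrite divr_gt0.
have [q q_gt0 lq] := semigroup_near0 l S_C0 c_gt0.
have y1_gt0 : 0 < `|y| + 1 by rewrite ltr_wpDl.
near \oo => n.
have hn_q : h n < q by near: n; exact: (cvgr_lt _ h_cvg).
have hn_y : h n < c / (`|y| + 1).
  by near: n; apply: (cvgr_lt _ h_cvg); rewrite divr_gt0.
have ln : `|l - x n| <= c by near: n; move/cvgrPdist_le : xl; exact.
(* The time [t] is rounded down to a multiple [s] of the step [h n], where the estimate for [x n]
   applies. *)
pose N := Num.truncn (t / h n); pose s := N%:R * h n.
have s_ge0 : 0 <= s by rewrite mulr_ge0 // ltW.
have /andP[st ts] : s <= t < s + h n.
  have := truncn_itv (divr_ge0 (ltW t_gt0) (ltW (h_gt0 n))).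
  by rewrite -/N ler_pdivlMr // ltr_pdivrMr // -natr1 mulrDl mul1r.
have ts_ge0 : 0 <= t - s by rewrite subr_ge0.
(* The terms are, in order: rounding the time in [S t l], replacing [l] by [x n] under [S s], the
   estimate for [x n], replacing [x n] back by [l], and rounding the time in [t *: y]. *)
have -> : S t l - l - t *: y = (S s (S (t - s) l - l) + S s (l - x n)) +
    (S s (x n) - x n - s *: y) - (l - x n) - (t - s) *: y.
  rewrite !linearB /= -SD // [s + _]addrC subrK scalerBl !opprB.
  rewrite opprK !addrA !subrK (addrAC _ (- l) (x n)).
  rewrite (addrAC _ (- (s *: y)) (x n)) subrK.
  by rewrite (addrAC _ (- l) (s *: y)) subrK.
apply: (le_trans (ler_normB _ _)).
have b1 : `|S s (S (t - s) l - l)| <= k * c.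
  apply: (le_trans (S_le _ _ s_ge0)); rewrite ler_pM2l //; apply: lq => //.
  by rewrite ltrBlDl (lt_trans ts) // ltrD2l.
have b2 : `|S s (l - x n)| <= k * c.
  by apply: (le_trans (S_le _ _ s_ge0)); rewrite ler_pM2l.
have b3 : `|S s (x n) - x n - s *: y| <= t * e.
  have : s * e <= t * e by rewrite ler_pM2r.
  apply: le_trans; apply: x_near => a a_ge0 ale; apply: yr => //.
  exact: le_lt_trans (le_trans ale st) tr.
have b4 : `|(t - s) *: y| <= c.
  rewrite normrZ ger0_norm // ltW //.
  apply: (@le_lt_trans _ _ (h n * (`|y| + 1))); last by rewrite -ltr_pdivlMr.
  apply: ler_pM => //; first by rewrite lerBlDl ltW.
  by rewrite lerDl.
have b5 : k * c + k * c + c + c = b.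
  by rewrite /c; field; rewrite gt_eqF.
have n1 := ler_normB (S s (S (t - s) l - l) + S s (l - x n) +
  (S s (x n) - x n - s *: y)) (l - x n).
have n2 := ler_normD (S s (S (t - s) l - l) + S s (l - x n))
  (S s (x n) - x n - s *: y).
have n3 := ler_normD (S s (S (t - s) l - l)) (S s (l - x n)).
lra.
Unshelve. all: by end_near.
Qed.

(** * Inverse of the generator and composition with the output operator *)

(** By Cauchy-Schwarz, [mu * |x| ^+ 2] is at most [2 * p * |A x| * |x|], where [p] bounds [P].
    Injectivity of [A] and the bound on its inverse are drawn from this. *)
Lemma lyapunov_bounded_below (R : realType) (X : normedModType R)
    (ip : {dot X for idfun}) (P : X -> X) (A : plinear X X) (mu : R) :
  (forall x, ip x x = `|x| ^+ 2) -> bounded_op Num.norm Num.norm P ->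
  0 < mu ->
  (forall x, pdom A x ->
     ip (A x) (P x) + ip (P x) (A x) <= - mu * `|x| ^+ 2) ->
  exists2 c : R, 0 < c & forall x, pdom A x -> `|x| <= c * `|A x|.
Proof.
move=> ip_norm /(bounded_op_gt0 (@normr_ge0 _ _))[p p_gt0 P_le] mu_gt0 P_lyap.
exists (2 * p / mu); first by rewrite divr_gt0 // mulr_gt0.
move=> x xA; have [->|x0] := eqVneq x 0.
  by rewrite normr0 mulr_ge0 // divr_ge0 ?mulr_ge0 // ltW.
have x_gt0 : 0 < `|x| by rewrite normr_gt0.
have := P_lyap _ xA; rewrite (dotC ip (P x)) => lyap.
have := dot_CauchySchwarz (@normr_ge0 _ _) ip_norm (A x) (P x).
rewrite ler_norml => /andP[cs _].
have APx : `|A x| * `|P x| <= `|A x| * (p * `|x|) by rewrite ler_wpM2l.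
rewrite mulrAC ler_pdivlMr // -(ler_pM2r x_gt0); lra.
Qed.

Lemma pinverse_spec (R : realType) (V W : lmodType R) (A : plinear V W)
    (y : W) :
  (exists x, pdom A x /\ A x = y) ->
  pdom A (pinverse A y) /\ A (pinverse A y) = y.
Proof.
by move=> Ay; exact: (@xgetPex _ 0 [set x | pdom A x /\ A x = y] Ay).
Qed.

Lemma plinear_bounded_below_inj (R : realType) (X : normedModType R)
    (W : normedModType R) (A : plinear X W) (c : R) (x y : X) :
  (forall x, pdom A x -> `|x| <= c * `|A x|) ->
  pdom A x -> pdom A y -> A x = A y -> x = y.
Proof.
move=> A_ge xA yA Axy; apply/eqP; rewrite -subr_eq0 -normr_le0 -opprB normrN.
rewrite addrC -scaleN1r (le_trans (A_ge _ (pdom_linear _ xA yA))) //.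
by rewrite pfun_linear // Axy scaleN1r addNr normr0 mulr0.
Qed.

(** [pinverse] selects a preimage by choice; the lower bound makes preimages unique, which forces
    the selection to be linear. *)
Lemma pfun_pinverse_linear (R : realType) (X W : normedModType R)
    (V : lmodType R) (A : plinear X W) (C : plinear X V) (c : R) :
  (forall x, pdom A x -> `|x| <= c * `|A x|) ->
  (forall y, exists x, pdom A x /\ A x = y) ->
  pdom A `<=` pdom C ->
  exists M : {linear W -> V}, forall y, M y = C (pinverse A y).
Proof.
move=> A_ge A_surj AC.
have pinvP y := pinverse_spec (A_surj y).
have lin : linear (fun y => C (pinverse A y)).
  move=> a u v; have [[uA Au] [vA Av]] := (pinvP u, pinvP v).
  rewrite -pfun_linear; [|exact: AC|exact: AC]; congr (C _).
  have [uvA Auv] := pinvP (a *: u + v).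
  apply: (plinear_bounded_below_inj A_ge) => //; first exact: pdom_linear.
  by rewrite Auv pfun_linear // Au Av.
pose M : {linear W -> V} := HB.pack (fun y => C (pinverse A y))
  (GRing.isLinear.Build R W V *:%R _ lin).
by exists M.
Qed.

(** * Adjoints and operators on column vectors *)

(** [adjoint] falls back to 0 when no representing vector exists; Riesz applied to [euclid (M v) w]
    as a function of [v] excludes that case. *)
Lemma adjointP (R : realType) (X : completeNormedModType R)
    (ip : {dot X for idfun}) (m : nat) (M : {linear X -> 'cV[R]_m}) :
  (forall x, ip x x = `|x| ^+ 2) -> bounded_op Num.norm (@enorm R m) M ->
  forall w v, ip v (adjoint ip (@euclid R m) M w) = euclid (M v) w.
Proof.
move=> ip_norm [c M_le] w.
have f_lin : scalar (fun v => euclid (M v) w).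
  by move=> a u v; rewrite linearP dotDl dotZl.
pose f : {scalar X} :=
  HB.pack (fun v => euclid (M v) w) (GRing.isLinear.Build R X R *%R _ f_lin).
have f_le : bounded_op Num.norm Num.norm f.
  exists (c * enorm w) => v /=.
  have cs := dot_CauchySchwarz (@enorm_ge0 R m) (fun u => esym (enorm_sqr u)).
  by rewrite (le_trans (cs _ _)) // mulrAC ler_wpM2r ?enorm_ge0.
have [x xf] := riesz_representation ip_norm f_le.
have : exists x, forall v, ip v x = euclid (M v) w.
  by exists x => v; rewrite dotC xf.
exact: (@xgetPex _ 0 [set x | forall v, ip v x = euclid (M v) w]).
Qed.

Lemma mx_of_op_mul (R : realType) (m n : nat)
    (f : {linear 'cV[R]_m -> 'cV[R]_n}) (z : 'cV[R]_m) :
  mx_of_op f *m z = f z.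
Proof.
rewrite {2}[z]matrix_sum_delta linear_sum; apply/colP => i.
rewrite mxE summxE; apply: eq_bigr => j _.
by rewrite big_ord1 linearZ !mxE mulrC.
Qed.

Lemma le_enorm (R : realType) (m : nat) (z : 'cV[R]_m) (i : 'I_m) :
  `|z i 0| <= enorm z.
Proof.
rewrite -sqrtr_sqr ler_wsqrtr // /euclid mxE (bigD1 i) //= mxE -expr2 lerDl.
by rewrite sumr_ge0 // => j _; rewrite mxE -expr2 sqr_ge0.
Qed.

Lemma linear_cV_bounded (R : realType) (X : normedModType R) (m : nat)
    (f : {linear 'cV[R]_m -> X}) : bounded_op (@enorm R m) Num.norm f.
Proof.
exists (\sum_i `|f (delta_mx i 0)|) => z.
rewrite {1}[z]matrix_sum_delta linear_sum mulr_suml.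
apply: (le_trans (ler_norm_sum _ _ _)); apply: ler_sum => i _.
by rewrite big_ord1 linearZ normrZ mulrC ler_wpM2l ?le_enorm.
Qed.

(** * The extended quadratic form and the closed loop *)

Lemma ip_extC (R : realType) (X : completeNormedModType R)
    (ip : {dot X for idfun}) (m : nat) (u v : X * 'cV[R]_m) :
  ip_ext ip u v = ip_ext ip v u.
Proof. by rewrite /ip_ext (dotC ip) (dotC (@euclid R m)). Qed.

(** The blocks of [P_ext] come from expanding the square of [z - M x]. Symmetry, positivity and the
    dissipation estimate are all read off this form. *)
Lemma ip_ext_P_ext (R : realType) (X : completeNormedModType R)
    (ip : {dot X for idfun}) (m : nat) (P : X -> X)
    (M : {linear X -> 'cV[R]_m}) (p : R) (u v : X * 'cV[R]_m) :
  (forall x, ip x x = `|x| ^+ 2) -> bounded_op Num.norm (@enorm R m) M ->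
  ip_ext ip u (P_ext ip P M p v) =
  ip u.1 (P v.1) + p * euclid (u.2 - M u.1) (v.2 - M v.1).
Proof.
move=> ip_norm M_bdd; rewrite /ip_ext /P_ext /= scaleNr.
rewrite !(dotDr ip) (dotNr ip) !(dotZr ip) !adjointP //.
rewrite !(dotDl (@euclid R m)) !(dotDr (@euclid R m)) !(dotNl (@euclid R m)).
rewrite !(dotNr (@euclid R m)) !(dotZr (@euclid R m)) /=; ring.
Qed.

Theorem theorem2 (R : realType) (X : completeNormedModType R)
  (ip : {dot X for idfun}) (ip_norm : forall x : X, ip x x = `|x| ^+ 2)
  (X_separable : separable X)
  (S : R -> {linear X -> X}) (A : plinear X X)
  (S_C0 : C0_semigroup S) (A_gen : is_generator S A)
  (S_stable : exponentially_stable S)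
  (m : nat) (B : {linear 'cV[R]_m -> X})
  (B_bounded : bounded_op (@enorm R m) Num.norm B)
  (C : plinear X 'cV[R]_m) (domAC : pdom A `<=` pdom C)
  (C_admissible : admissible S A C)
  (rank_CAB : \rank (mx_of_op (fun z : 'cV[R]_m => C (pinverse A (B z)))) = m)
  (P : {linear X -> X})
  (P_bounded : bounded_op Num.norm Num.norm P)
  (P_self_adjoint : self_adjoint ip P) (P_positive : positive_op ip P)
  (mu : R) (mu_gt0 : 0 < mu)
  (P_lyapunov : forall x, pdom A x ->
     ip (A x) (P x) + ip (P x) (A x) <= - mu * `|x| ^+ 2) :
  exists (Ki : 'M[R]_m) (M : {linear X -> 'cV[R]_m}) (p ki_max : R),
    [/\ \rank Ki = m, bounded_op Num.norm (@enorm R m) M, 0 < p, 0 < ki_max &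
      forall ki : R, 0 < ki -> ki < ki_max ->
      exists mu_e : R,
        [/\ 0 < mu_e,
            self_adjoint (ip_ext ip) (P_ext ip P M p),
            positive_op (ip_ext ip) (P_ext ip P M p) &
            forall (x : X) (z : 'cV[R]_m), pdom A x ->
              ip_ext ip (A_ext A B C Ki ki (x, z)) (P_ext ip P M p (x, z)) +
              ip_ext ip (P_ext ip P M p (x, z)) (A_ext A B C Ki ki (x, z))
              <= - mu_e * (`|x| ^+ 2 + enorm z ^+ 2)]].
Proof.
have [c c_gt0 A_ge] :=
  lyapunov_bounded_below ip_norm P_bounded mu_gt0 P_lyapunov.
have A_surj y := stable_generator_surjective y S_C0 A_gen S_stable.
have [M MC] := pfun_pinverse_linear A_ge A_surj domAC.
have [[r r_gt0 C_le] _] := C_admissible.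
(* The relative bound of [C] is applied at the preimage of [y], whose norm is at most [c * |y|]. *)
have M_bdd : bounded_op Num.norm (@enorm R m) M.
  exists (r * (c + 1)) => y; have [xA xy] := pinverse_spec (A_surj y).
  rewrite MC (le_trans (C_le _ xA)) // xy -mulrA ler_pM2l // mulrDl mul1r.
  by rewrite lerD2r -{2}xy A_ge.
have MA x : pdom A x -> M (A x) = C x.
  move=> xA; rewrite MC; congr (C _).
  have [yA Ay] := pinverse_spec (A_surj (A x)).
  exact: (plinear_bounded_below_inj A_ge).
pose G := mx_of_op (M \o B).
(* [G] is the matrix of the rank hypothesis, with [M] written for [C] after [pinverse A]. *)
have G_unit : G \in unitmx.
  rewrite -row_free_unit /row_free -[X in _ == X]rank_CAB; apply/eqP.
  by congr (\rank _); apply/matrixP => i j; rewrite !mxE /= MC.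
pose Ki := invmx G.
have MBK z : M (B (Ki *m z)) = z.
  by rewrite -[LHS](mx_of_op_mul (M \o B)) mulmxA mulmxV ?mul1mx.
have [b b_gt0 BK_le] : exists2 b, 0 < b &
    forall z, `|B (Ki *m z)| <= b * enorm z.
  exact: bounded_op_gt0 (@enorm_ge0 R m) (linear_cV_bounded (B \o mulmx Ki)).
have [a a_gt0 P_le] := bounded_op_gt0 (@normr_ge0 _ _) P_bounded.
have [q q_gt0 M_le] := bounded_op_gt0 (@normr_ge0 _ _) M_bdd.
(* [K] adds the coefficients of [|x| ^+ 2] from the two Young estimates below. Gains under
   [mu / (2 * K)] let the cross terms consume at most half of [mu]. *)
pose K := 2 * b ^+ 2 * a ^+ 2 + 2 * q ^+ 2.
have K_gt0 : 0 < K by rewrite /K addr_gt0 // !mulr_gt0 ?exprn_gt0.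
exists Ki, M, 1, (mu / (2 * K)); split=> //.
- by rewrite mxrank_unit // unitmx_inv.
- by rewrite divr_gt0 // mulr_gt0.
move=> k k_gt0; rewrite ltr_pdivlMr ?mulr_gt0 // => k_lt.
(* What survives the cross terms: [mu / 2] of the decay in [x], and [k] out of the [2 * k] in
   [z]. *)
exists (Num.min (mu / 2) k); split.
- by rewrite lt_min k_gt0 divr_gt0.
- move=> u v; rewrite ip_extC !ip_ext_P_ext // !mul1r -P_self_adjoint.
  by rewrite (dotC ip) (dotC (@euclid R m)).
- move=> [x z] xz0; rewrite ip_ext_P_ext // mul1r /=.
  have zM_ge0 := dot_ge0 (@euclid R m) (z - M x).
  have [x0|/P_positive xP] := eqVneq x 0; last by rewrite ltr_wpDr.
  have z0 : z != 0 by apply: contraNneq xz0 => ->; rewrite x0.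
  by rewrite x0 !linear0 add0r addr0 neq0_dnorm_gt0.
move=> x z xA; rewrite (ip_extC ip (P_ext _ _ _ _ _)) !ip_ext_P_ext // mul1r /=.
(* The component of the flow along [z - M x]: [C x] cancels against [M (A x)]. *)
have -> : C x - M (A x + k *: B (Ki *m z)) = - (k *: z).
  by rewrite linearD linearZ /= MBK MA // opprD addrA subrr add0r.
set w := enorm z ^+ 2; set n := `|x| ^+ 2.
have w_ge0 : 0 <= w by exact: sqr_ge0.
have n_ge0 : 0 <= n by exact: sqr_ge0.
(* The weight is chosen so that the bound [b] on [B] after [Ki] leaves exactly [w / 2]; [young_z]
   leaves the other half. *)
have young_u : 2 * ip (B (Ki *m z)) (P x) <= w / 2 + 2 * b ^+ 2 * a ^+ 2 * n.
  have s_gt0 : 0 < (2 * b ^+ 2)^-1 by rewrite invr_gt0 mulr_gt0 ?exprn_gt0.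
  apply: (le_trans (dot_young ip _ _ s_gt0)); rewrite !ip_norm invrK lerD //.
    rewrite mulrC ler_pdivrMr ?mulr_gt0 ?exprn_gt0 //.
    rewrite (_ : w / 2 * _ = (b * enorm z) ^+ 2); last by rewrite /w; field.
    by rewrite ler_sqr ?nnegrE // mulr_ge0 ?enorm_ge0 // ltW.
  rewrite -[leRHS]mulrA ler_pM2l ?mulr_gt0 ?exprn_gt0 // /n -exprMn.
  by rewrite ler_sqr ?nnegrE // mulr_ge0 // ltW.
have young_z : 2 * euclid z (M x) <= w / 2 + 2 * q ^+ 2 * n.
  have s_gt0 : 0 < 2^-1 :> R by rewrite invr_gt0.
  apply: (le_trans (dot_young (@euclid R m) _ _ s_gt0)).
  rewrite /= -!enorm_sqr invrK (mulrC 2^-1) lerD //.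
  rewrite -[leRHS]mulrA ler_pM2l // /n -exprMn.
  by rewrite ler_sqr ?nnegrE ?enorm_ge0 // mulr_ge0 // ltW.
have lyap : 2 * ip (A x) (P x) <= - mu * n.
  by have := P_lyapunov _ xA; rewrite (dotC ip (P x)) -/n; lra.
have cross : k * (2 * ip (B (Ki *m z)) (P x) + 2 * euclid z (M x))
    <= k * (w + K * n).
  by rewrite ler_pM2l // /K; lra.
have knK : n * (k * (2 * K)) <= n * mu by rewrite ler_wpM2l // ltW.
have min_w : Num.min (mu / 2) k * w <= k * w.
  by rewrite ler_wpM2r // ge_min lexx orbT.
have min_n : Num.min (mu / 2) k * n <= mu / 2 * n.
  by rewrite ler_wpM2r // ge_min lexx.
have zz : euclid z z = w by rewrite /w enorm_sqr.
rewrite dotDl dotZl (dotNl (@euclid R m)) (dotZl (@euclid R m)).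
rewrite (dotDr (@euclid R m)) (dotNr (@euclid R m)) /= zz; lra.
Qed.
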